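(* Let $(S,\leq)$ be a partially ordered set and let $\lambda\colon S\to T$ be a length function on $S$ with values in a partially ordered set $T$. Then there exists a map $\mu\colon S\to U$ into a partially ordered set $U$ satisfying for all $x,y\in S$ the following: \begin{enumerate} \item[(M1)] $x\leq y$ implies $\mu(x)\leq\mu(y)$. \item[(M2)] $\mu(x)=\mu(y)$ implies $\lambda(x)=\lambda(y)$. \item[(M3)] If $\mu(x')<\mu(y)$ for all $x'\in S$ with $x'<x$, and $\lambda(x)\geq\lambda(y)$, then $\mu(x)\leq\mu(y)$. \end{enumerate} Moreover, for any map $\mu'\colon S\to U'$ into a partially ordered set $U'$ satisfying the conditions (M1)--(M3) (with $\mu'$ in place of $\mu$), we have $$\mu'(x)\leq\mu'(y)\quad\Longleftrightarrow\quad\mu(x)\leq\mu(y)\quad\text{for all}\quad x,y\in S.$$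
   Context: A length function on a partially ordered set $(S,\leq)$ is a map $\lambda\colon S\to T$ into a partially ordered set $T$ such that for all $x,y\in S$: (L1) $x<y$ implies $\lambda(x)<\lambda(y)$; (L2) $\lambda(x)\leq\lambda(y)$ or $\lambda(y)\leq\lambda(x)$; (L3) the set $\{\lambda(x')\mid x'\in S,\ x'\leq x\}$ is finite. *)

(* Defs.v *)
From HB Require Import structures.
From mathcomp Require Import all_boot all_order.
From mathcomp Require Import boolp classical_sets functions cardinality.

Set Implicit Arguments.
Unset Strict Implicit.
Unset Printing Implicit Defensive.

Local Open Scope classical_set_scope.
Local Open Scope order_scope.

(* [porderType] carries a boolean order and a choice structure; under the
   classical axioms of [boolp] every partially ordered set has these. *)

Record length_function (dS dT : Order.disp_t) (S : porderType dS)
    (T : porderType dT) (lambda : S -> T) : Prop := LengthFunction {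
  length_lt : forall x y : S, x < y -> lambda x < lambda y ;
  length_total : forall x y : S, lambda x <= lambda y \/ lambda y <= lambda x ;
  length_finite : forall x : S,
    finite_set [set lambda x' | x' in [set x' : S | x' <= x]] }.

(* The axioms of a Gabriel-Roiter measure with respect to [lambda]. *)
Record GR_measure (dS dT dU : Order.disp_t) (S : porderType dS)
    (T : porderType dT) (U : porderType dU) (lambda : S -> T) (mu : S -> U)
    : Prop := GRMeasure {
  GR_le : forall x y : S, x <= y -> mu x <= mu y ;
  GR_eq : forall x y : S, mu x = mu y -> lambda x = lambda y ;
  GR_max : forall x y : S, (forall x' : S, x' < x -> mu x' < mu y) ->
    lambda y <= lambda x -> mu x <= mu y }.

(* Main.v *)
(** Existence: let mu x be the lexicographically largest among the increasing
    words lambda x_1 < ... < lambda x_n coming from chains x_1 < ... < x_n = x,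
    where letters of T are compared in the reversed order, so that a word gets
    larger when a letter decreases or when letters are appended.  (L3) makes
    these words finite in number, hence the maximum exists, and its last letter
    recovers lambda x.  Removing the last element of a chain realising mu x
    gives (M3).

    Uniqueness: (M1)-(M3) force the values of mu to be totally ordered and
    express [mu x <= mu y] through comparisons in which x or y is replaced by
    a strictly smaller element.  Since S is well founded by (L3), the relation
    [mu x <= mu y] is thus the same for all mu. *)

Require Import Defs.
From HB Require Import structures.
From mathcomp Require Import all_boot all_order.
From mathcomp Require Import boolp classical_sets functions cardinality.

Set Implicit Arguments.
Unset Strict Implicit.
Unset Printing Implicit Defensive.

Import Order.TTheory.

Local Open Scope order_scope.

Section WellFounded.
Variables (dS dT : Order.disp_t) (S : porderType dS) (T : porderType dT).
Variables (lambda : S -> T) (hlambda : length_function lambda).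

Lemma length_values (x : S) :
  exists l : seq T, forall x', x' <= x -> lambda x' \in l.
Proof.
have /finite_seqP[l el] := length_finite hlambda x.
exists l => x' lex.
have : [set lambda x' | x' in [set x' : S | x' <= x]]%classic (lambda x').
  by exists x'.
by rewrite el.
Qed.

(** Induction on the length of a list containing all values of [lambda] below [x]: passing to some
    [x' < x] allows [lambda x] to be deleted, since by (L1) it is no longer attained. *)
Lemma length_wf : well_founded (fun x y : S => x < y).
Proof.
move=> x; have [l] := length_values x.
have [n] := ubnP (size l); elim: n l x => [//|n IHn] l x ltln hl.
apply: Acc_intro => x' ltx.
apply: (IHn [seq t <- l | t != lambda x]) => [|z lezx'].
  move: ltln; rewrite ltnS size_filter; apply: leq_trans.
  by rewrite -(count_predC (pred1 (lambda x)) l) -{1}[count _ l]add0n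
    ltn_add2r -has_count has_pred1 hl.
have ltzx : z < x := le_lt_trans lezx' ltx.
by rewrite mem_filter hl ?(ltW ltzx) // (lt_eqF (length_lt hlambda ltzx)).
Qed.

End WellFounded.

Section Uniqueness.
Variables (dS dT dU : Order.disp_t) (S : porderType dS) (T : porderType dT).
Variables (U : porderType dU) (lambda : S -> T) (mu : S -> U).
Hypotheses (hlambda : length_function lambda) (hmu : GR_measure lambda mu).

(** Let [y] have the larger [lambda] value. Either (M3) applies to it, or some [y' < y] violates its
    premise; by induction [mu y'] is comparable with [mu x], so [mu x <= mu y' <= mu y]. *)
Lemma GR_total (x y : S) : mu x <= mu y \/ mu y <= mu x.
Proof.
elim/(well_founded_ind (length_wf hlambda)): x y => x IHx y.
elim/(well_founded_ind (length_wf hlambda)): y => y IHy.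
have [lexy|leyx] := length_total hlambda x y.
- have [hy|] := pselect (forall y', y' < y -> mu y' < mu x).
    by right; apply: (GR_max hmu).
  move=> /existsNP[y' /not_implyP[lty' nlt]]; left.
  have [le1|] := IHy _ lty'; first exact: le_trans le1 (GR_le hmu (ltW lty')).
  rewrite le_eqVlt => /orP[/eqP <-|//].
  exact (GR_le hmu (ltW lty')).
- have [hx|] := pselect (forall x', x' < x -> mu x' < mu y).
    by left; apply: (GR_max hmu).
  move=> /existsNP[x' /not_implyP[ltx' nlt]]; right.
  have [|le1] := IHx _ ltx' y; last exact: le_trans le1 (GR_le hmu (ltW ltx')).
  rewrite le_eqVlt => /orP[/eqP <-|//].
  exact (GR_le hmu (ltW ltx')).
Qed.

Lemma GR_ltNge (x y : S) : mu x < mu y <-> ~ mu y <= mu x.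
Proof.
split=> [ltxy|nle]; first by rewrite (lt_geF ltxy).
have [] := GR_total x y => //; rewrite le_eqVlt => /orP[/eqP exy|//].
by case: nle; rewrite exy.
Qed.

(** This makes (M3) an equivalence: [mu x <= mu y <= mu x'] with [x' < x] would force
    [mu x = mu x'], against (M2) and (L1). *)
Lemma GR_le_below (x y : S) : lambda y <= lambda x ->
  mu x <= mu y <-> forall x', x' < x -> ~ mu y <= mu x'.
Proof.
move=> leyx; split=> [lexy x' ltx' leyx'|hx].
  have ltl := length_lt hlambda ltx'.
  have exx' : mu x = mu x'.
    apply/le_anti; rewrite (le_trans lexy leyx').
    exact (GR_le hmu (ltW ltx')).
  by move: ltl; rewrite (GR_eq hmu exx') ltxx.
by apply: (GR_max hmu) => // x' ltx'; apply/GR_ltNge/hx.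
Qed.

(** Without such a [y'], (M3) gives [mu y <= mu x]; equality is then excluded by (M2). *)
Lemma GR_le_above (x y : S) : lambda x < lambda y ->
  mu x <= mu y <-> exists2 y', y' < y & mu x <= mu y'.
Proof.
move=> ltxy; split=> [lexy|[y' lty' lexy']]; last first.
  exact: le_trans lexy' (GR_le hmu (ltW lty')).
apply: contrapT => hy.
have leyx : mu y <= mu x.
  apply: (GR_max hmu) (ltW ltxy) => y' lty'; apply/GR_ltNge => le'.
  by apply: hy; exists y'.
have exy : mu x = mu y by apply/le_anti; rewrite lexy leyx.
by move: ltxy; rewrite (GR_eq hmu exy) ltxx.
Qed.

End Uniqueness.

Lemma GR_unique (dS dT dU dV : Order.disp_t) (S : porderType dS)
    (T : porderType dT) (U : porderType dU) (V : porderType dV)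
    (lambda : S -> T) (mu : S -> U) (nu : S -> V) :
    length_function lambda -> GR_measure lambda mu -> GR_measure lambda nu ->
  forall x y, mu x <= mu y <-> nu x <= nu y.
Proof.
move=> hl hmu hnu x y.
(* The two recursive characterisations swap the roles of x and y, so both
   comparisons have to be carried through the induction. *)
suff [] : (mu x <= mu y <-> nu x <= nu y) /\ (mu y <= mu x <-> nu y <= nu x).
  by [].
elim/(well_founded_ind (length_wf hl)): x y => x IHx y.
elim/(well_founded_ind (length_wf hl)): y => y IHy.
have below a b (leba : lambda b <= lambda a) :
    (forall a', a' < a -> mu b <= mu a' <-> nu b <= nu a') ->
  mu a <= mu b <-> nu a <= nu b.
  move=> IH; rewrite (GR_le_below hl hmu leba) (GR_le_below hl hnu leba).
  by split=> h a' lta' /(IH _ lta'); apply: h.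
have above a b (ltab : lambda a < lambda b) :
    (forall b', b' < b -> mu a <= mu b' <-> nu a <= nu b') ->
  mu a <= mu b <-> nu a <= nu b.
  move=> IH; rewrite (GR_le_above hl hmu ltab) (GR_le_above hl hnu ltab).
  by split=> -[b' ltb' /(IH _ ltb') h]; exists b'.
have IHx' x' (ltx' : x' < x) : mu y <= mu x' <-> nu y <= nu x'.
  by have [] := IHx _ ltx' y.
have IHy' y' (lty' : y' < y) : mu x <= mu y' <-> nu x <= nu y'.
  by have [] := IHy _ lty'.
have [lexy|leyx] := length_total hl x y.
  (* [above] needs a strict inequality of [lambda] values; if they are equal, [below] serves both
     directions. *)
  split; last exact: below.
  move: lexy; rewrite le_eqVlt => /orP[/eqP exy|ltxy]; last exact: above.
  by apply: below; rewrite ?exy.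
split; first exact: below.
move: leyx; rewrite le_eqVlt => /orP[/eqP exy|ltyx]; last exact: above.
by apply: below; rewrite ?exy.
Qed.

Lemma total_max (d : Order.disp_t) (U : porderType d) (P : U -> Prop)
    (l : seq U) :
    (forall s t, P s -> P t -> s <= t \/ t <= s) ->
    (forall s, P s -> s \in l) -> (exists s, P s) ->
  exists2 s, P s & forall t, P t -> t <= s.
Proof.
elim: l P => [|a l IHl] P totP Pl [s Ps]; first by have := Pl _ Ps.
have [[s' [Ps' nsa]]|noP] := pselect (exists s', P s' /\ s' != a); last first.
  have Pa t : P t -> t = a.
    by move=> Pt; apply/eqP/negPn/negP => nta; apply: noP; exists t.
  by exists s => // t Pt; rewrite (Pa _ Ps) (Pa _ Pt).
have [|||m [Pm nma] max_m] := IHl (fun t => P t /\ t != a).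
- by move=> t u [Pt _] [Pu _]; apply: totP.
- by move=> t [Pt nta]; have := Pl _ Pt; rewrite inE (negPf nta).
- by exists s'.
have [Pa|nPa] := pselect (P a); last first.
  exists m => // t Pt; apply: max_m; split=> //; apply/eqP => eta.
  by apply: nPa; rewrite -eta.
have [lema|leam] := totP _ _ Pm Pa; [exists a|exists m] => // t Pt.
  by have [->//|nta] := eqVneq t a; apply: le_trans (max_m _ _) lema.
by have [->//|nta] := eqVneq t a; apply: max_m.
Qed.

Lemma bounded_words (T : eqType) (l : seq T) (n : nat) :
  exists L : seq (seq T), forall s, (size s <= n)%N -> {subset s <= l} ->
    s \in L.
Proof.
elim: n => [|n [L hL]].
  by exists [:: [::]] => s; rewrite leqn0 size_eq0 => /eqP->.
exists ([::] :: [seq a :: s | a <- l, s <- L]) => -[//|a s] /= les sub.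
rewrite inE; apply/orP; right; apply/allpairsP; exists (a, s); split=> //=.
  by apply: sub; rewrite mem_head.
by apply: hL => // t ts; apply: sub; rewrite inE ts orbT.
Qed.

(* [rcons s a] is the least word above [s] all of whose letters are bounded
   by [a]; this is the combinatorial content of (M3). *)
Lemma lexi_rcons_le (d : Order.disp_t) (T : porderType d) (a : T)
    (s u : seqlexi T^d) :
  s < u -> (forall t : T, t \in (u : seq T) -> t <= a) ->
  (rcons s a : seqlexi T^d) <= u.
Proof.
elim: s u => [|b s IHs] [|c u] //=.
  move=> _ hu; rewrite lexi_cons.
  by rewrite leEdual (hu c (mem_head _ _)) implybT.
rewrite ltxi_cons lexi_cons.
case/andP=> -> /implyP lt hu /=; apply/implyP => lecb.
by apply: IHs (lt lecb) _ => t tu; apply: hu; rewrite inE tu orbT.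
Qed.

Lemma lexi_rcons (d : Order.disp_t) (T : porderType d) (a : T)
    (s : seqlexi T^d) : s <= (rcons s a : seqlexi T^d).
Proof.
elim: s => [|b s IHs] //=.
by rewrite lexi_cons lexx.
Qed.

Section Existence.
Variables (dS dT : Order.disp_t) (S : porderType dS) (T : porderType dT).
Variables (lambda : S -> T) (hlambda : length_function lambda).

(* Chains are stored from the top [x] downwards, their words in increasing
   order. *)
Definition word (p : seq S) : seqlexi T^d := rev (map lambda p).

Definition chain_word (x : S) (s : seqlexi T^d) : Prop :=
  exists2 p : seq S, path >%O x p & s = word (x :: p).

Lemma word_cons (x : S) (p : seq S) :
  word (x :: p) = rcons (word p) (lambda x).
Proof. by rewrite /word /= rev_cons. Qed.

Lemma chain_word_rcons (x y : S) (s : seqlexi T^d) :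
  x < y -> chain_word x s -> chain_word y (rcons s (lambda y)).
Proof.
by move=> ltxy [p xp ->]; exists (x :: p); rewrite ?word_cons //= ltxy.
Qed.

Lemma chain_word_letters (x : S) (s : seqlexi T^d) : chain_word x s ->
  forall t : T, t \in (s : seq T) -> exists2 x', x' <= x & t = lambda x'.
Proof.
move=> [p xp ->] t; rewrite mem_rev => /mapP[z zp ->]; exists z => //.
move: zp; rewrite inE => /orP[/eqP-> //|zp].
by have /allP/(_ z zp)/ltW := order_path_min (rev_trans lt_trans) xp.
Qed.

(** Words over [T] need not be comparable, but here every letter is a value of [lambda], so (L2)
    applies. *)
Lemma word_total (p q : seq S) : word p <= word q \/ word q <= word p.
Proof.
rewrite /word -!map_rev; elim: (rev p) (rev q) => [|x s IHs] [|y u] //=;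
  [by left|by left|by right|].
rewrite !lexi_cons !leEdual.
case: (lambda x <= lambda y) (lambda y <= lambda x) (length_total hlambda x y).
  by case=> _ /=; [exact: IHs|right].
by case=> [_|[]//] /=; left.
Qed.

Lemma chain_word_max (x : S) :
  exists2 s, chain_word x s & forall t, chain_word x t -> t <= s.
Proof.
have [l hl] := length_values hlambda x.
(* By (L1) the letters of a chain word are pairwise distinct, and they lie in [l]; hence the bound
   [size l] on its length. *)
have [L hL] := bounded_words l (size l).
apply: (@total_max _ (seqlexi T^d) (chain_word x) L); last by exists (word [:: x]); exists [::].
  by move=> _ _ [p _ ->] [q _ ->]; apply: word_total.
move=> s ws.
have sub : {subset (s : seq T) <= l}.
  by move=> t /(chain_word_letters ws)[x' lex ->]; apply: hl.
apply: hL => //; apply: uniq_leq_size sub.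
have [p xp ->] := ws; rewrite rev_uniq.
apply: (@sorted_uniq _ >%O); [exact: rev_trans lt_trans|exact: ltxx|].
by apply: homo_path xp => y z; apply: length_lt.
Qed.

Definition GR_word (x : S) : seqlexi T^d := sval (cid2 (chain_word_max x)).

Lemma GR_wordP (x : S) : chain_word x (GR_word x).
Proof. by rewrite /GR_word; case: cid2. Qed.

Lemma GR_word_ub (x : S) (s : seqlexi T^d) : chain_word x s -> s <= GR_word x.
Proof. by rewrite /GR_word; case: cid2 => m /= _; apply. Qed.

Lemma GR_word_measure : GR_measure lambda GR_word.
Proof.
split=> [x y|x y|x y ltxy leyx].
- rewrite le_eqVlt => /orP[/eqP->//|ltxy].
  apply: le_trans (lexi_rcons (lambda y) (GR_word x)) _.
  exact/GR_word_ub/chain_word_rcons/GR_wordP.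
- have [p _ ->] := GR_wordP x; have [q _ ->] := GR_wordP y.
  by rewrite !word_cons => /rcons_inj[].
- have bound t : t \in (GR_word y : seq T) -> t <= lambda x.
    case/(chain_word_letters (GR_wordP y)) => y' ley' ->.
    apply: le_trans leyx; move: ley'; rewrite le_eqVlt => /orP[/eqP->//|].
    by move/(length_lt hlambda)/ltW.
  (* It remains to see that [word p < GR_word y]. If [p] is empty, so is its word, while [GR_word y]
     is not; otherwise [p] is a chain with top [x' < x], and its word is at most [GR_word x']. *)
  have [p xp ->] := GR_wordP x; rewrite word_cons; apply: lexi_rcons_le bound.
  case: p xp => [_|x' p /= /andP[ltx' xp]].
    have [q _ ->] := GR_wordP y; rewrite word_cons.
    by case: (word q).
  apply: le_lt_trans (ltxy _ ltx'); apply: GR_word_ub; by exists p.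
Qed.

End Existence.

Theorem theorem1p7 (dS dT : Order.disp_t) (S : porderType dS)
    (T : porderType dT) (lambda : S -> T) (hlambda : length_function lambda) :
  exists (dU : Order.disp_t) (U : porderType dU) (mu : S -> U),
    GR_measure lambda mu /\
    (forall (dU' : Order.disp_t) (U' : porderType dU') (mu' : S -> U'),
      GR_measure lambda mu' ->
      forall x y : S, mu' x <= mu' y <-> mu x <= mu y).
Proof.
exists _, (seqlexi T^d), (GR_word hlambda).
have hmu := GR_word_measure hlambda.
by split=> // dU' U' mu' hmu' x y; apply: (GR_unique hlambda).
Qed.
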